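(* $\mathbb{Q}$ witnesses that $2^{\mathbb{N}}$, $\mathbb{Z}^{\mathbb{N}}$, $\mathbb{R}^{\mathbb{N}}$, and $(\mathbb{R}\setminus\mathbb{Q})^{\mathbb{N}}$, ordered lexicographically, are not strongly surjective; that is, for each of these orders $M$, $\mathbb{Q}$ embeds into $M$ but there is no epimorphism from $M$ onto $\mathbb{Q}$.
   Context: An embedding is an order preserving injection; an epimorphism is an order preserving surjection. A (non-empty) linear order $M$ is strongly surjective if for every non-empty linear order $L$ that embeds into $M$ there is an epimorphism from $M$ onto $L$. For a linear order $L$, $L^{\mathbb{N}}$ is the set of all sequences $\mathbb{N}\to L$; in the lexicographic order two distinct sequences are compared at the least index where they differ. Here $2=\{0,1\}$ with $0<1$. *)

(* Defs.v *)
From HB Require Import structures.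
From mathcomp Require Import all_boot all_order all_algebra.
From mathcomp Require Import boolp classical_sets functions reals.

Set Implicit Arguments.
Unset Strict Implicit.
Unset Printing Implicit Defensive.

Import Order.TTheory GRing.Theory Num.Theory.

Local Open Scope classical_set_scope.
Local Open Scope order_scope.

Definition embeds d d' (L : orderType d) (M : orderType d') : Prop :=
  exists f : L -> M, {homo f : x y / x <= y} /\ injective f.

Definition epi_onto d d' (M : orderType d) (L : orderType d') : Prop :=
  exists f : M -> L,
    {homo f : x y / x <= y} /\ set_surj [set: M] [set: L] f.

(* Linear orders M are assumed non-empty; this is automatic in the uses below,
   since a non-empty order embeds into M. *)
Definition strongly_surjective d (M : orderType d) : Prop :=
  forall d' (L : orderType d'), inhabited L -> embeds L M -> epi_onto M L.

Definition witnesses_not_strongly_surjective d d'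
    (L : orderType d) (M : orderType d') : Prop :=
  [/\ ~ strongly_surjective M, embeds L M & ~ epi_onto M L].

(* An alias of [nat -> L], needed because [boolp] equips the bare function
   type with the pointwise order. *)
Definition lexseq (L : Type) : Type := nat -> L.

Section LexSeq.
Context d (L : orderType d).
Implicit Types s t u : lexseq L.

HB.instance Definition _ := Choice.copy (lexseq L) (nat -> L).

Definition lexseq_lt s t : bool :=
  `[< exists n, (forall m, (m < n)%N -> s m = t m) /\ s n < t n >].

Definition lexseq_le s t : bool := (s == t) || lexseq_lt s t.

Fact lexseq_lt_irr : irreflexive lexseq_lt.
Proof. by move=> s; apply/asboolP => -[n [_]]; rewrite ltxx. Qed.

Fact lexseq_lt_trans : transitive lexseq_lt.
Proof.
move=> t s u /asboolP[n [eqst ltst]] /asboolP[k [eqtu lttu]]; apply/asboolP.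
case: (ltngtP n k) => [nk|kn|nk].
- exists n; split=> [m mn|]; last by rewrite -eqtu.
  by rewrite eqst// eqtu// (ltn_trans mn).
- exists k; split=> [m mk|]; last by rewrite eqst.
  by rewrite eqst ?eqtu// (ltn_trans mk).
- subst k; exists n; split=> [m mn|]; last exact: lt_trans lttu.
  by rewrite eqst// eqtu.
Qed.

Fact lexseq_lt_total s t : s != t -> lexseq_lt s t || lexseq_lt t s.
Proof.
move=> neq; have ex : exists n, s n != t n.
  apply: contrapT => /forallNP eqst; move/eqP: neq; apply; apply/funext => n.
  by apply/eqP/negPn/negP/eqst.
have least m : (m < ex_minn ex)%N -> s m = t m.
  case: ex_minnP => n _ minn mn; apply/eqP/negPn/negP => /minn.
  by rewrite leqNgt mn.
move: least; case: ex_minnP => n nst _ least.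
case: (ltgtP (s n) (t n)) nst => // ltn _; apply/orP; [left|right];
  by apply/asboolP; exists n; split=> // m /least.
Qed.


HB.instance Definition _ := Order.LtOrder.Build (Order.seqlexi_display d)
  (lexseq L) (fun _ _ => erefl) (fun _ _ => erefl) (fun _ _ => erefl)
  lexseq_lt_irr lexseq_lt_trans lexseq_lt_total.

End LexSeq.

Section SetTypeOrder.
Context d (T : orderType d) (A : set T).

HB.instance Definition _ := SubChoice.copy (set_type A) {x : T | x \in A}.
HB.instance Definition _ :=
  Order.SubChoice_isSubOrder.Build d T _ d (set_type A).

End SetTypeOrder.

(* Main.v *)
(** Call [L] segment-free if no monotone map [L -> rat] has a rational segment
    [[p, q]], [p < q], as its range. If [L] is segment-free, a monotone
    surjection [f] from [lexseq L] onto [rat] is refuted by diagonalization: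
    list the rationals as [r_n] and build nested pairs [u_n <= v_n] agreeing
    below [n], with [f u_n < f v_n] and [r_n] outside [[f u_(n+1), f v_(n+1)]];
    their common limit then has no possible value under [f]. A pair agreeing
    below [n] with distinct values contains one agreeing below [n+1]: otherwise
    [f] would depend only on the [n]-th coordinate there. [bool] and [int] are
    segment-free because they have jumps. For an order embedded in the reals
    with countable complement, each of the uncountably many irrational cuts of
    [[p, q]] would pull back to a distinct real outside the order. *)

Require Import Defs.
From mathcomp Require Import all_boot all_order all_algebra.
From mathcomp Require Import boolp classical_sets functions reals.
From mathcomp Require Import cardinality ereal lebesgue_measure.
From mathcomp Require Import zify lra.

Set Implicit Arguments.
Unset Strict Implicit.
Unset Printing Implicit Defensive.

Import Order.TTheory GRing.Theory Num.Theory.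

Local Open Scope classical_set_scope.
Local Open Scope order_scope.

(** * Lexicographic order: agreement, limits and nested intervals *)

Section Lexicographic.
Context d (L : orderType d).
Implicit Types (s t u : lexseq L) (n : nat).

Definition agree n s t := forall m, (m < n)%N -> s m = t m.

Lemma lexseq_ltP s t :
  reflect (exists n, agree n s t /\ s n < t n) (s < t).
Proof. exact: asboolP. Qed.

Lemma lexseq_le_at n s t : s <= t -> agree n s t -> s n <= t n.
Proof.
rewrite le_eqVlt => /predU1P[->//|/lexseq_ltP[k [eqst ltst]]] agr.
case: (ltngtP k n) => [kn|nk|<-]; last exact: ltW.
- by move: ltst; rewrite agr// ltxx.
- by rewrite eqst.
Qed.

(** By induction: once the three agree below a coordinate, weak comparison there squeezes [t]
    between two equal values. *)
Lemma agree_between n s t u : s <= t -> t <= u -> agree n s u -> agree n s t.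
Proof.
move=> st tu; elim: n => [//|n IH] su m.
have {}IH : agree n s t by apply: IH => k kn; apply: su; apply: ltnW.
have tu' : agree n t u by move=> k kn; rewrite -IH// su// ltnW.
rewrite ltnS leq_eqVlt => /predU1P[->|/IH//].
by apply/le_anti; rewrite lexseq_le_at//= (su n)// lexseq_le_at.
Qed.

(** If [t < s] were decided at coordinate [k], every [u] agreeing with [t] through [k] would also
    lie below [s]. *)
Lemma lexseq_ge_closed s t :
  (forall n, exists2 u, agree n u t & s <= u) -> s <= t.
Proof.
move=> approx; rewrite leNgt; apply/negP => /lexseq_ltP[k [ts lt_ts]].
have [u ut su] := approx k.+1; move: lt_ts; rewrite -ut//.
apply/negP; rewrite -leNgt; apply: lexseq_le_at su _ => m mk.
by rewrite -ts// ut// ltnW.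
Qed.

Lemma lexseq_le_closed s t :
  (forall n, exists2 u, agree n u t & u <= s) -> t <= s.
Proof.
move=> approx; rewrite leNgt; apply/negP => /lexseq_ltP[k [st lt_st]].
have [u ut us] := approx k.+1; move: lt_st; rewrite -ut//.
apply/negP; rewrite -leNgt; apply: lexseq_le_at us _ => m mk.
by rewrite st// ut// ltnW.
Qed.

Lemma nested_intervals_meet (a b : nat -> lexseq L) :
  (forall n, agree n (a n) (b n)) ->
  (forall n, a n <= a n.+1 /\ b n.+1 <= b n) ->
  (forall n, a n <= b n) ->
  exists x, forall n, a n <= x <= b n.
Proof.
move=> agr step ab.
have aS n : a n <= a n.+1 by case: (step n).
have bS n : b n.+1 <= b n by case: (step n).
have amono := homo_leq (@le_refl _ _) (@le_trans _ _) aS.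
have bmono : {homo b : m n / (m <= n)%N >-> n <= m}.
  by apply: homo_leq => // y x z xy yz; exact: le_trans yz xy.
(* Coordinate [m] is settled from stage [m.+1] on: later terms lie between [a m.+1] and [b m.+1],
   which agree there. *)
pose x : lexseq L := fun m => a m.+1 m.
have ax n : agree n (a n) x.
  move=> m mn; rewrite /x; symmetry.
  apply: (@agree_between m.+1 _ _ (b m.+1)) => //; first exact: amono.
  exact: le_trans (ab n) (bmono _ _ _).
exists x => n; apply/andP; split.
- apply: lexseq_ge_closed => k; exists (a (maxn n k)).
    by move=> m mk; apply: ax; rewrite leq_max mk orbT.
  by apply: amono; rewrite leq_maxl.
- apply: lexseq_le_closed => k; exists (a (maxn n k)).
    by move=> m mk; apply: ax; rewrite leq_max mk orbT.
  by apply: le_trans (ab _) _; apply: bmono; rewrite leq_maxl.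
Qed.

(** Each rational goes to the characteristic sequence, with values [a] and [b], of its open lower
    cut along an enumeration; a larger cut is pointwise larger. *)
Lemma rat_embeds_lexseq (a b : L) : a < b -> embeds rat (lexseq L).
Proof.
move=> ab.
pose below (q : rat) (n : nat) :=
  if unpickle n is Some r then (r : rat) < q else false.
pose f (q : rat) : lexseq L := fun n => if below q n then b else a.
have f_lt : {homo f : p q / p < q}.
  move=> p q pq; rewrite lt_neqAle; apply/andP; split.
    (* The coordinate coding [p] separates the images: [p < q], but not [p < p]. *)
    apply/eqP => /(congr1 (fun s : lexseq L => s (pickle p))).
    rewrite /f /below pickleK ltxx pq => /eqP.
    by rewrite (lt_eqF ab).
  rewrite leNgt; apply/negP => /lexseq_ltP[n [_]]; rewrite /f /below.
  case: unpickle => [r|]; last by rewrite ltxx.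
  case: ifP => [_|rq]; first by case: ifP; rewrite ?ltxx// ltNge ltW.
  by rewrite (@le_gtF _ _ p r) ?ltxx// (le_trans (ltW pq))// leNgt rq.
exists f; split; first exact/ltW_homo.
exact/inc_inj/le_mono.
Qed.

End Lexicographic.

(** * Segment-free orders and the diagonalization *)

Definition rat_segment (p q : rat) : set rat := [set r | p <= r <= q].

Definition segment_free d (L : orderType d) :=
  forall (g : L -> rat) p q, {homo g : x y / x <= y} -> p < q ->
    range g <> rat_segment p q.

Section NoEpi.
Context d (L : orderType d) (f : lexseq L -> rat).
Hypothesis f_homo : {homo f : x y / x <= y}.
Hypothesis f_surj : forall r, exists x, f x = r.
Hypothesis L_free : segment_free L.
Implicit Types (u v x y : lexseq L) (n : nat) (q r : rat).

Let f_lt x y : f x < f y -> x < y.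
Proof. by rewrite !ltNge; apply: contra; exact: f_homo. Qed.

Lemma shrink_avoiding u v q : f u < f v ->
  exists u' v', [/\ u <= u', v' <= v, f u' < f v' & ~~ (f u' <= q <= f v')].
Proof.
move=> fuv; pose m := ((f u + f v) / 2)%R.
have [um mv] : f u < m /\ m < f v by rewrite /m; split; lra.
have [qm|mq] := leP q m.
(* The new left value must exceed [m] strictly, since [q] may equal [m]. *)
- have [x fx] := f_surj ((m + f v) / 2)%R.
  have ux : u < x by apply: f_lt; rewrite fx; lra.
  exists x, v; rewrite lexx ltW//; split=> //; first by rewrite fx; lra.
  by rewrite negb_and -ltNge fx; apply/orP; left; lra.
- have [x fx] := f_surj m.
  have xv : x < v by apply: f_lt; rewrite fx.
  exists u, x; rewrite lexx ltW// fx um; split=> //.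
  by rewrite negb_and -!ltNge mq orbT.
Qed.

(* If [f] were constant on the classes of [agree n.+1] inside [[u, v]], it would
   factor through the [n]-th coordinate, giving a monotone map [L -> rat] whose
   range is a segment. *)
Lemma deepen n u v : agree n u v -> f u < f v ->
  exists u' v', [/\ u <= u', v' <= v, f u' < f v' & agree n.+1 u' v'].
Proof.
move=> uv fuv; apply: contrapT => /forallNP none.
have f_eq x y : u <= x <= v -> u <= y <= v -> agree n.+1 x y -> f x = f y.
  move=> /andP[ux xv] /andP[uy yv] xy.
  case: (ltgtP (f x) (f y)) => // fxy; exfalso.
  - by apply: (none x); exists y.
  - by apply: (none y); exists x; split=> // m /xy.
have le_uv := ltW (f_lt fuv).
have uvn : u n < v n.
  rewrite lt_neqAle lexseq_le_at// andbT; apply/eqP => eqn.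
  suff : f u = f v by move=> fE; move: fuv; rewrite fE ltxx.
  apply: f_eq; rewrite ?lexx ?le_uv// => m.
  by rewrite ltnS leq_eqVlt => /predU1P[->|/uv].
pose mid c : lexseq L := fun m => if (m < n)%N then u m else c.
have mid_agree c : agree n u (mid c) by move=> m mn; rewrite /mid mn.
have midn c : mid c n = c by rewrite /mid ltnn.
(* A monotone choice of representatives in [[u, v]], clamped to the endpoints because [mid c] may
   leave the interval when [c] is not strictly between [u n] and [v n]. *)
pose w c := if c <= u n then u else if v n <= c then v else mid c.
have w_mid c : u n < c -> c < v n -> u <= mid c <= v.
  move=> uc cv; apply/andP; split; apply/ltW/lexseq_ltP; exists n.
    by rewrite midn.
  by split; rewrite ?midn// => m mn; rewrite -mid_agree// uv.
have w_in c : u <= w c <= v.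
  rewrite /w; case: (leP c (u n)) => [_|uc]; first by rewrite lexx le_uv.
  by case: (leP (v n) c) => [_|cv]; [rewrite lexx le_uv|exact: w_mid].
have w_homo : {homo w : a b / a <= b}.
  move=> a b ab; rewrite {1}/w; case: (leP a (u n)) => [_|ua].
    by case/andP: (w_in b).
  rewrite /w (leNgt b) (lt_le_trans ua ab)/=; case: (leP (v n) a) => [va|av].
    by rewrite (le_trans va ab).
  case: (leP (v n) b) => [_|bv]; first by case/andP: (w_mid a ua av).
  case: (ltgtP a b) ab => // [lab _|->//].
  apply/ltW/lexseq_ltP; exists n; split; rewrite ?midn// => m mn.
  by rewrite -!mid_agree.
have w_agree x : u <= x <= v -> agree n.+1 (w (x n)) x.
  move=> /andP[ux xv] m; have uxn := agree_between ux xv uv.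
  have xvn : agree n x v by move=> k kn; rewrite -uxn// uv.
  have uxle := lexseq_le_at ux uxn; have xvle := lexseq_le_at xv xvn.
  rewrite ltnS leq_eqVlt /w => /predU1P[->|mn].
    case: (leP (x n) (u n)) => [xu|_]; first by apply/le_anti; rewrite xu uxle.
    case: (leP (v n) (x n)) => [vx|_]; last by rewrite midn.
    by apply/le_anti; rewrite vx xvle.
  case: (leP (x n) (u n)) => _; first exact: uxn.
  by case: (leP (v n) (x n)) => _; [rewrite xvn|rewrite -mid_agree// uxn].
apply: (L_free (g := f \o w) (p := f u) (q := f v)) => //.
  by move=> a b ab; apply/f_homo/w_homo.
apply/seteqP; split=> [_ [c _ <-]|r /andP[ur rv]] /=.
  by rewrite /rat_segment/=; case/andP: (w_in c) => *; rewrite !f_homo.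
have [x [/andP[ux xv] <-]] : exists x, u <= x <= v /\ f x = r.
  move: ur; rewrite le_eqVlt => /predU1P[<-|ur].
    by exists u; rewrite lexx.
  move: rv; rewrite le_eqVlt => /predU1P[->|rv].
    by exists v; rewrite lexx andbT.
  have [x fx] := f_surj r; exists x; split=> //.
  by rewrite !ltW//; apply: f_lt; rewrite fx.
have uxv : u <= x <= v by rewrite ux.
by exists (x n) => //=; apply: f_eq => //; exact: w_agree.
Qed.

(** One stage of the diagonalization: avoid [q], then deepen the agreement. The premises sit under
    the existential so that choice gives a step function on all pairs. *)
Lemma refine n q (uv : lexseq L * lexseq L) :
  exists uv', agree n uv.1 uv.2 -> f uv.1 < f uv.2 ->
    [/\ uv.1 <= uv'.1, uv'.2 <= uv.2, f uv'.1 < f uv'.2, agree n.+1 uv'.1 uv'.2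
      & ~~ (f uv'.1 <= q <= f uv'.2)].
Proof.
case: uv => u v /=; have [[uv fuv]|no] := pselect (agree n u v /\ f u < f v);
  last by exists (u, v) => *; exfalso; apply: no.
have [u1 [v1 [uu1 v1v fuv1 avoid]]] := shrink_avoiding q fuv.
have uv1 := ltW (f_lt fuv1).
have ag1 : agree n u1 v1.
  have agu x : u <= x -> x <= v -> agree n u x.
    by move=> ux xv; exact: agree_between ux xv uv.
  move=> m mn; rewrite -(agu u1 uu1 (le_trans uv1 v1v) m mn).
  by rewrite (agu v1 (le_trans uu1 uv1) v1v m mn).
have [u2 [v2 [u12 v21 fuv2 ag2]]] := deepen ag1 fuv1.
exists (u2, v2) => _ _; split=> //=; first exact: le_trans uu1 u12.
  exact: le_trans v21 v1v.
apply: contra avoid => /andP[uq qv].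
by rewrite (le_trans (f_homo u12) uq) (le_trans qv (f_homo v21)).
Qed.

Lemma no_monotone_surjection : False.
Proof.
pose enum n : rat := odflt 0%R (unpickle n).
have /choice[F FP] : forall nuv : nat * (lexseq L * lexseq L), exists uv', _ :=
  fun nuv => refine nuv.1 (enum nuv.1) nuv.2.
have [[u0 fu0] [v0 fv0]] := (f_surj 0%R, f_surj 1%R).
pose uv := fix uv n := if n is k.+1 then F (k, uv k) else (u0, v0).
have inv n : agree n (uv n).1 (uv n).2 /\ f (uv n).1 < f (uv n).2.
  elim: n => [|n [ag lt]]; first by split=> //=; rewrite fu0 fv0.
  by have [] := FP (n, uv n) ag lt.
have step n := FP (n, uv n) (inv n).1 (inv n).2.
have [||n|x xP] :=
  @nested_intervals_meet _ L (fun n => (uv n).1) (fun n => (uv n).2).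
- by move=> n; case: (inv n).
- by move=> n; case: (step n).
- by apply/ltW/f_lt; case: (inv n).
(* The value [f x] was excluded at the stage of its own code, yet [x] lies in the interval built
   there. *)
case: (step (pickle (f x))) => /= _ _ _ _; rewrite /enum pickleK /=.
by have /andP[/= ux xv] := xP (pickle (f x)).+1; rewrite !f_homo.
Qed.

End NoEpi.

Lemma segment_free_witnesses d (L : orderType d) (a b : L) :
  a < b -> segment_free L -> witnesses_not_strongly_surjective rat (lexseq L).
Proof.
move=> ab free; have emb := rat_embeds_lexseq ab.
have noepi : ~ epi_onto (lexseq L) rat.
  move=> [f [f_homo f_surj]].
  apply: (no_monotone_surjection f_homo _ free) => r.
  by have [x _ <-] := f_surj r I; exists x.
split=> // ss; apply: noepi; apply: ss => //.
exact: (inhabits (0%R : rat)).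
Qed.

(** * Orders with jumps: [bool] and [int] *)

(** The midpoint of [g a] and [g b] lies in the segment, but monotonicity keeps every value of [g]
    at or outside [g a] and [g b]. *)
Lemma jump_not_segment d (L : orderType d) (g : L -> rat) (p q : rat)
    (a b : L) :
  {homo g : x y / x <= y} -> g a < g b -> (forall c, c <= a \/ b <= c) ->
  range g <> rat_segment p q.
Proof.
move=> g_homo gab gap rg.
have seg c : rat_segment p q (g c) by rewrite -rg; exists c.
have [m [am mb]] : exists m, g a < m /\ m < g b.
  by exists ((g a + g b) / 2)%R; split; lra.
have : rat_segment p q m.
  have /andP[pa _] := seg a; have /andP[_ bq] := seg b.
  by rewrite /rat_segment/= (le_trans pa (ltW am)) (le_trans (ltW mb) bq).
rewrite -rg => -[c _ gc]; move: am mb; rewrite -gc.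
by case: (gap c) => /g_homo; rewrite leNgt => /negPf ->.
Qed.

Lemma segment_ends d (L : orderType d) (g : L -> rat) (p q : rat) :
  p < q -> range g = rat_segment p q -> exists a b, g a = p /\ g b = q.
Proof.
move=> pq rg.
have [a _ ga] : range g p by rewrite rg /rat_segment/= lexx ltW.
have [b _ gb] : range g q by rewrite rg /rat_segment/= lexx ltW.
by exists a, b.
Qed.

Lemma segment_free_bool : segment_free bool.
Proof.
move=> g p q g_homo pq rg; have [a [b [ga gb]]] := segment_ends pq rg.
apply: (jump_not_segment (a := false) (b := true)) rg => //; last first.
  by case; [right|left].
have : g false <= p by rewrite -ga g_homo.
move/le_lt_trans; apply; apply: lt_le_trans pq _.
by rewrite -gb g_homo//; case: (b).
Qed.

Lemma segment_free_int : segment_free int.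
Proof.
move=> g p q g_homo pq rg; have [a [b [ga gb]]] := segment_ends pq rg.
have ab : a < b.
  by rewrite ltNge; apply/negP => /g_homo; rewrite ga gb leNgt pq.
(* Without a strict increase at some unit step, [g] could not climb from [p] at [a] to [q] at
   [b]. *)
have [n gn] : exists n : nat, g (a + n%:Z)%R < g (a + n.+1%:Z)%R.
  apply: contrapT => /forallNP flat.
  have gconst (n : nat) : g (a + n%:Z)%R <= g a.
    elim: n => [|n IH]; first by rewrite addr0.
    by apply: le_trans IH; rewrite leNgt; apply/negP/flat.
  have ba : (0 <= b - a)%R by rewrite subr_ge0 ltW.
  by have := gconst `|b - a|%N; rewrite gez0_abs// subrKC ga gb leNgt pq.
apply: (jump_not_segment (a := (a + n%:Z)%R) (b := (a + n.+1%:Z)%R)) rg => // c.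
by case: (leP c (a + n%:Z)%R) => [|nc]; [left|right; lia].
Qed.

(** * Orders embedded in the reals with countable complement *)

Local Open Scope ring_scope.

(** Countable sets are Lebesgue null, whereas the interval has measure [b - a]. *)
Lemma itv_uncountable (R : realType) (a b : R) : a < b ->
  ~ countable `]a, b[%classic.
Proof.
move=> ab /countable_lebesgue_measure0.
rewrite lebesgue_measure_itv/= lte_fin ab.
by apply/eqP; rewrite gt_eqF// -EFinB lte_fin subr_gt0.
Qed.

Lemma countable_rational (R : realType) : countable (@rational R).
Proof. exact: sub_countable (card_image_le _ _) (countableP _). Qed.

Lemma irrational_in_itv (R : realType) (a b : R) : a < b ->
  exists2 x, irrational x & a < x < b.
Proof.
move=> ab; apply: contrapT => none; apply: (itv_uncountable ab).
apply: sub_countable (countable_rational R); apply: subset_card_le => x /=.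
by rewrite in_itv/= => xab; apply: contrapT => irr; apply: none; exists x.
Qed.

Lemma setU_countable T (A B : set T) :
  countable A -> countable B -> countable (A `|` B).
Proof.
by move=> cA cB; rewrite -bigcup2E; apply: bigcup_countable => // -[|[|i]] _ /=;
  rewrite /bigcup2/=.
Qed.

(* Each real [t] in [(p, q)] gives the cut [sup {e a | g a < t}]; distinct [t]
   give distinct cuts, and the cut of an irrational [t] cannot lie in the range
   of [e], for there [g] would take the value [t]. *)
Lemma segment_free_cocountable (R : realType) d (L : orderType d) (e : L -> R) :
  {mono e : x y / (x < y)%O} -> countable (~` range e) -> segment_free L.
Proof.
move=> e_mono ctb g p q g_homo pq rg.
have g_lt x y : g x < g y -> (x < y)%O.
  by rewrite !ltNge; apply: contra; exact: g_homo.
have [a0 [b0 [ga0 gb0]]] := segment_ends pq rg.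
pose I : set R := `]ratr p, ratr q[%classic.
pose S (t : R) : set R := [set e a | a in [set a | ratr (g a) < t]].
pose cut t : R := sup (S t).
have value (s t : R) : ratr p <= s -> s < t -> t <= ratr q ->
    exists a, s < ratr (g a) /\ ratr (g a) < t.
  move=> ps st tq.
  have [r] := rat_in_itvoo st; rewrite in_itv/= => /andP[sr rt].
  have : rat_segment p q r.
    by rewrite /rat_segment/= -!(ler_rat R); apply/andP; split; lra.
  by rewrite -rg => -[a _ ga]; exists a; rewrite ga.
have cut_le t b : t <= ratr (g b) -> ratr p < t -> cut t <= e b.
  move=> tb pt; apply: ge_sup; first by exists (e a0), a0 => //=; rewrite ga0.
  move=> _ [a /= at_ <-]; apply/ltW; rewrite e_mono; apply: g_lt.
  by rewrite -(ltr_rat R); exact: lt_le_trans at_ tb.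
have le_cut t b : ratr (g b) < t -> t <= ratr q -> e b <= cut t.
  move=> bt tq; apply: ub_le_sup; last by exists b.
  exists (e b0) => _ [a /= at_ <-]; apply/ltW; rewrite e_mono; apply: g_lt.
  by rewrite gb0 -(ltr_rat R); exact: lt_le_trans at_ tq.
have cut_lt : {in I &, {homo cut : s t / s < t}}.
  move=> s t; rewrite !inE /I/= !in_itv/= => /andP[ps sq] /andP[pt tq] st.
  (* Two intermediate values are needed for strictness: [cut s <= e a < e b <= cut t]. *)
  have [b [sb bt]] := value s t (ltW ps) st (ltW tq).
  have [a [sa ab]] := value s _ (ltW ps) sb (ltW (lt_trans bt tq)).
  apply: (@le_lt_trans _ _ (e a)); first by apply: cut_le => //; exact: ltW.
  apply: (@lt_le_trans _ _ (e b)); last by apply: le_cut => //; exact: ltW.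
  by rewrite e_mono; apply: g_lt; rewrite -(ltr_rat R).
have cut_out t : I t -> ~ rational t -> ~ range e (cut t).
  rewrite /I/= in_itv/= => /andP[pt tq] irr [x _ ex].
  (* If [g x] differs from [t], a value of [g] strictly between them puts some [e a] on the wrong
     side of [cut t = e x]. *)
  case: (ltgtP (ratr (g x)) t) => [xt|tx|xt].
  - have px : ratr p <= ratr (g x) :> R.
      have : range g (g x) by exists x.
      by rewrite rg ler_rat => /andP[].
    have [a [xa at_]] := value _ _ px xt (ltW tq).
    have := le_cut _ _ at_ (ltW tq); rewrite -ex leNgt e_mono => /negP; apply.
    by apply: g_lt; rewrite -(ltr_rat R).
  - have xq : ratr (g x) <= ratr q :> R.
      have : range g (g x) by exists x.
      by rewrite rg ler_rat => /andP[].
    have [a [ta ax]] := value _ _ (ltW pt) tx xq.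
    have := cut_le _ _ (ltW ta) pt; rewrite -ex leNgt e_mono => /negP; apply.
    by apply: g_lt; rewrite -(ltr_rat R).
  - by apply: irr; exists (g x).
have : ~ countable I by apply: itv_uncountable; rewrite ltr_rat.
apply; apply: (@sub_countable _ _ _ (rational `|` (I `\` rational))).
  by apply: subset_card_le => t It; case: (pselect (rational t)); [left|right].
apply: setU_countable; first exact: countable_rational.
have cut_inj : {in I `\` rational &, injective cut}.
  move=> s t; rewrite !inE => -[/mem_set Is _] [/mem_set It _] st.
  case: (ltgtP s t) => // lt.
    by have := cut_lt _ _ Is It lt; rewrite st ltxx.
  by have := cut_lt _ _ It Is lt; rewrite st ltxx.
(* [cut] injects the irrational points of [I] into the countable complement of [range e]. *)
rewrite -(eq_countable (inj_card_eq cut_inj)); apply: sub_countable ctb.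
by apply: subset_card_le => _ [t [It irr] <-]; exact: cut_out.
Qed.

Theorem corollary5p10 (R : realType) :
  [/\ witnesses_not_strongly_surjective rat (lexseq bool),
      witnesses_not_strongly_surjective rat (lexseq int),
      witnesses_not_strongly_surjective rat (lexseq R) &
      witnesses_not_strongly_surjective rat (lexseq (set_type (@irrational R)))].
Proof.
split.
- exact: (@segment_free_witnesses _ _ false true) segment_free_bool.
- exact: (@segment_free_witnesses _ _ 0 1) segment_free_int.
- apply: (@segment_free_witnesses _ _ 0 1) => //.
  apply: (@segment_free_cocountable R _ _ id) => //.
  by rewrite image_id setCT; exact: countable0.
- pose I := set_type (@irrational R).
  have rangeC : ~` range (val : I -> R) `<=` rational.
    move=> x nx; apply: contrapT => irr; apply: nx.
    by exists (Sub x (mem_set irr)).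
  (* Irrationals taken from [(0, 1)] and [(1, 2)] are separated by [1]. *)
  have [x [y xy]] : exists x y : I, (x < y)%O.
    have [x irrx /andP[_ x1]] := irrational_in_itv (@ltr01 R).
    have lt12 : 1 < 2 :> R by rewrite ltr1n.
    have [y irry /andP[y1 _]] := irrational_in_itv lt12.
    exists (Sub x (mem_set irrx)), (Sub y (mem_set irry)).
    exact: lt_trans x1 y1.
  apply: (segment_free_witnesses xy).
  apply: (@segment_free_cocountable R _ _ val) => //.
  by apply: sub_countable (countable_rational R); exact: subset_card_le.
Qed.
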